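(* Let $\mathfrak D$ be the complex mirror Heisenberg-Virasoro algebra. Any compatible left-symmetric algebra structure on $\mathfrak D$ satisfying the natural grading condition is given by the following multiplication table (for all $m,n\in\mathbb Z$; all other products of basis elements are zero): $$d_m d_n=-\frac{n(1+\epsilon n)}{1+\epsilon(m+n)}\,d_{m+n}+\frac1{24}\big(m^3-m+(\epsilon-\epsilon^{-1})m^2\big)\delta_{m+n,0}\,\mathbf c,$$ $$d_m h_{n+\frac12}=-\Big(n+\tfrac12\Big)h_{m+n+\frac12},$$ $$h_{m+\frac12}h_{n+\frac12}=\tfrac12\Big(m+\tfrac12\Big)\delta_{m+n+1,0}\,\mathbf l,$$ where $\epsilon\in\mathbb C$ satisfies $\epsilon\neq0$ and $\epsilon^{-1}\notin\mathbb Z$.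
   Context: The mirror Heisenberg-Virasoro algebra $\mathfrak D$ is the complex Lie algebra with basis $\{d_m,\ h_r,\ \mathbf c,\ \mathbf l\mid m\in\mathbb Z,\ r\in\frac12+\mathbb Z\}$ and brackets (those not determined by the following and skew-symmetry are zero) $$[d_m,d_n]=(m-n)d_{m+n}+\tfrac{m^3-m}{12}\delta_{m+n,0}\,\mathbf c,\quad [d_m,h_r]=-r\,h_{m+r},\quad [h_r,h_s]=r\,\delta_{r+s,0}\,\mathbf l,$$ for $m,n\in\mathbb Z$, $r,s\in\frac12+\mathbb Z$. A left-symmetric algebra is an algebra with bilinear product $xy$ satisfying $(xy)z-x(yz)=(yx)z-y(xz)$ for all $x,y,z$. A compatible left-symmetric algebra structure on a Lie algebra $\mathfrak L$ is a left-symmetric product on the vector space $\mathfrak L$ such that $xy-yx=[x,y]$ for all $x,y\in\mathfrak L$. Natural grading condition: a product on $\mathfrak D$ satisfies it if there are functions $f,g,h,a,b,\omega,\rho:\mathbb Z\times\mathbb Z\to\mathbb C$ such that for all $m,n\in\mathbb Z$ $$d_m d_n=f(m,n)d_{m+n}+\omega(m,n)\mathbf c,\qquad d_m h_{n+\frac12}=g(m,n)h_{m+n+\frac12},$$ $$h_{m+\frac12}d_n=h(m,n)h_{m+n+\frac12},\qquad h_{m+\frac12}h_{n+\frac12}=a(m,n)d_{m+n}+b(m,n)h_{m+n+\frac12}+\rho(m,n)\mathbf l,$$ and every product of basis elements in which $\mathbf c$ or $\mathbf l$ is a factor is zero. *)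

(* Defs.v *)
From HB Require Import structures.
From mathcomp Require Import all_boot all_order all_algebra.
From mathcomp Require Import finmap reals.
From mathcomp.real_closed Require Import complex.
From mathcomp.multinomials Require Import monalg.

Set Implicit Arguments.
Unset Strict Implicit.
Unset Printing Implicit Defensive.

Import GRing.Theory Num.Theory.
Local Open Scope ring_scope.

(* [Bh n] stands for h_{n + 1/2}, so [Bh] enumerates the h_r, r in 1/2 + Z. *)
Inductive mhv_basis : Type := Bd of int | Bh of int | Bc | Bl.

Definition mhv_basis_encode (x : mhv_basis) : int + int + bool :=
  match x with
  | Bd m => inl (inl m)
  | Bh n => inl (inr n)
  | Bc => inr true
  | Bl => inr false
  end.

Definition mhv_basis_decode (x : int + int + bool) : mhv_basis :=
  match x with
  | inl (inl m) => Bd m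
  | inl (inr n) => Bh n
  | inr true => Bc
  | inr false => Bl
  end.

Lemma mhv_basis_encodeK : cancel mhv_basis_encode mhv_basis_decode.
Proof. by case. Qed.

HB.instance Definition _ := Countable.copy mhv_basis (can_type mhv_basis_encodeK).

(* Finitely supported R[i]-valued functions on the basis. *)
Definition mhv (R : realType) : lmodType R[i] := {malg R[i][mhv_basis]}.

Section MirrorHeisenbergVirasoro.
Variable R : realType.

Definition vect (x : mhv_basis) : mhv R := << x >>.

Definition vd (m : int) : mhv R := vect (Bd m).
Definition vh (n : int) : mhv R := vect (Bh n).
Definition vc : mhv R := vect Bc.
Definition vl : mhv R := vect Bl.

Definition half_int (n : int) : R[i] := n%:~R + 2^-1.

Definition mhv_bracket_basis (x y : mhv_basis) : mhv R :=
  match x, y with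
  | Bd m, Bd n =>
      (m - n)%:~R *: vd (m + n)
      + ((m ^+ 3 - m)%:~R / 12 * (m + n == 0)%:R) *: vc
  | Bd m, Bh n => - half_int n *: vh (m + n)
  | Bh n, Bd m => half_int n *: vh (m + n)
  | Bh m, Bh n => (half_int m * (m + n + 1 == 0)%:R) *: vl
  | _, _ => 0
  end.

Definition mhv_bracket (u v : mhv R) : mhv R :=
  \sum_(x <- msupp u) \sum_(y <- msupp v)
    (u@_x * v@_y) *: mhv_bracket_basis x y.

Definition left_symmetric (mul : mhv R -> mhv R -> mhv R) : Prop :=
  forall x y z : mhv R,
    mul (mul x y) z - mul x (mul y z) = mul (mul y x) z - mul y (mul x z).

Definition compatible_left_symmetric (mul : mhv R -> mhv R -> mhv R) : Prop :=
  left_symmetric mul /\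
  forall x y : mhv R, mul x y - mul y x = mhv_bracket x y.

(* In h_{m+1/2} h_{n+1/2}, the d- and h-components both have index m + n,
   although m + 1/2 + n + 1/2 = m + n + 1. *)
Definition natural_grading (mul : mhv R -> mhv R -> mhv R) : Prop :=
  exists f g h a b omega rho : int -> int -> R[i],
    [/\ forall m n : int,
          mul (vd m) (vd n) = f m n *: vd (m + n) + omega m n *: vc,
        forall m n : int, mul (vd m) (vh n) = g m n *: vh (m + n),
        forall m n : int, mul (vh m) (vd n) = h m n *: vh (m + n),
        forall m n : int,
          mul (vh m) (vh n) =
            a m n *: vd (m + n) + b m n *: vh (m + n) + rho m n *: vl
      & forall x : mhv_basis,
          [/\ mul vc (vect x) = 0, mul (vect x) vc = 0,
              mul vl (vect x) = 0 & mul (vect x) vl = 0]].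

Definition mhv_table (eps : R[i]) (x y : mhv_basis) : mhv R :=
  match x, y with
  | Bd m, Bd n =>
      - (n%:~R * (1 + eps * n%:~R) / (1 + eps * (m + n)%:~R)) *: vd (m + n)
      + (24^-1 * ((m ^+ 3 - m)%:~R + (eps - eps^-1) * (m ^+ 2)%:~R)
          * (m + n == 0)%:R) *: vc
  | Bd m, Bh n => - half_int n *: vh (m + n)
  | Bh m, Bh n => (2^-1 * half_int m * (m + n + 1 == 0)%:R) *: vl
  | _, _ => 0
  end.

End MirrorHeisenbergVirasoro.

(* Main.v *)
From HB Require Import structures.
Require Import Defs.
From mathcomp Require Import all_boot all_order all_algebra.
From mathcomp Require Import finmap reals.
From mathcomp.real_closed Require Import complex.
From mathcomp.multinomials Require Import monalg.
From mathcomp Require Import zify ring.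

Set Implicit Arguments.
Unset Strict Implicit.
Unset Printing Implicit Defensive.

Import GRing.Theory Num.Theory.
Local Open Scope ring_scope.

(** Write [d_m d_n = f(m,n) d_{m+n} + w(m,n) c], and so on.  Left-symmetry says
    that left multiplication represents the Lie algebra, so on basis vectors it
    becomes quadratic identities between the structure functions, and the
    brackets fix the antisymmetric part of each of them.

    _The Virasoro part._  The representation identity with [d_0] shows that
    [f(k,0)] is [0] or [f(0,0)], and that [f(m,k) <> 0] forces
    [f(m+k,0) = f(k,0)].  If [f(0,0) <> 0], the set of [k] with [f(k,0) <> 0]
    and its complement are closed under sums of distinct elements, so the set is
    all of Z or essentially a half-line; the central cocycle excludes the former
    and a direct evaluation of [f(3,3)] the latter ([right_weight_eq0]).  Hence
    [f(k,0) = 0], and [f(0,k) = -k].  A rescaling of the basis then brings the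
    representation to the form [f(m,k) phi(m+k) = -k phi(k)] off the lines
    [k = 0] and [m+k = 0] ([exists_gauge]).  The bracket condition turns into
    [m phi(m) - k phi(k) = (m-k) phi(m+k)], whose solutions on nonzero integers
    are exactly the affine functions ([affine_of_eq]).  The same functional
    equation governs [f(m,-m)] and [w(m,-m)] after division by the expected
    factor ([cocycle_affine]).  Comparing with the bracket leaves the parameter
    [eps] and, when [eps = 0], one more; the central charge rules out [eps = 0]
    and determines [w] ([virasoro_form]).

    _The Heisenberg part._  The [l]-components of the products [h_r h_s] make
    [rho(r,-r)] nowhere zero, and express the action of [d_m] on the [h_r]
    through a single function [T] with [T(r) + T(-r) = 1].  The identity for
    [d_m, h_r, d_k] with [m = k = 1] and [m = k = -1] shows that a nonconstant
    [T] needs [f(1,1) + f(-1,-1) = 0], which fails as [eps <> 0].  So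
    [T = 1/2]; all remaining structure functions follow ([heisenberg_form]). *)

(** * A functional equation on the nonzero integers *)
Section Scalars.
Variable K : numFieldType.

(** With [lincomb2], reduces an equation implied linearly by known ones to a
    ring identity: [c], [c'] are the multipliers of the known equations. *)
Lemma lincomb1 (c a b x y : K) : x = y -> a - b = c * (x - y) -> a = b.
Proof. by move=> ->; rewrite subrr mulr0 => /eqP; rewrite subr_eq0 => /eqP. Qed.

Lemma lincomb2 (c c' a b x y x' y' : K) : x = y -> x' = y' ->
  a - b = c * (x - y) + c' * (x' - y') -> a = b.
Proof. by move=> -> -> /eqP; rewrite !subrr !mulr0 addr0 subr_eq0 => /eqP. Qed.

(** The equation with [n = 1] and [n = -1] is a two-term recursion that
    propagates the zeros outwards, except where [m - n] or a factor vanishes;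
    there, [t (-1)] comes from [(2, -1)] and [t (-2)] from [(-2, 1)]. *)
Lemma affine_eq_eq0 (t : int -> K) :
  (forall m n : int, m != 0 -> n != 0 -> m + n != 0 ->
     m%:~R * t m - n%:~R * t n = (m - n)%:~R * t (m + n)) ->
  t 1 = 0 -> t 2 = 0 -> forall m : int, m != 0 -> t m = 0.
Proof.
move=> tE t1 t2.
have step p m n : m != 0 -> n != 0 -> m + n = p -> p != 0 -> m != n ->
    t m = 0 -> t n = 0 -> t p = 0.
  move=> m0 n0 <- p0 mn tm tn; move: (tE m n m0 n0 p0).
  rewrite tm tn !mulr0 subrr => /esym/eqP; rewrite mulf_eq0 intr_eq0 subr_eq0.
  by rewrite (negPf mn) => /eqP.
have tN1 : t (-1) = 0.
  have := tE 2 (-1) isT isT isT; rewrite t2 (t1 : t (2 + -1) = 0) => /eqP.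
  by rewrite !mulr0 sub0r -mulNr mulf_eq0 oppr_eq0 intr_eq0 => /eqP.
have pos (n : nat) : t n.+1%:Z = 0.
  elim: n => [//|[//|n] IHn].
  apply: (step _ n.+2%:Z 1) => //; lia.
have tN2 : t (-2) = 0.
  have := tE (-2) 1 isT isT isT; rewrite t1 (tN1 : t (-2 + 1) = 0) => /eqP.
  by rewrite !mulr0 subr0 mulf_eq0 intr_eq0 => /eqP.
have neg (n : nat) : t (- n.+1%:Z) = 0.
  elim: n => [//|[//|n] IHn].
  apply: (step _ (- n.+2%:Z) (-1)) => //; lia.
by case=> [[//|n] _|n _]; rewrite ?NegzE.
Qed.

(** Affine functions are solutions, so subtracting the one that agrees with [t]
    at [1] and [2] reduces to [affine_eq_eq0]. *)
Lemma affine_of_eq (t : int -> K) :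
  (forall m n : int, m != 0 -> n != 0 -> m + n != 0 ->
     m%:~R * t m - n%:~R * t n = (m - n)%:~R * t (m + n)) ->
  exists u v, forall m : int, m != 0 -> t m = u + v * m%:~R.
Proof.
move=> tE; exists (2 * t 1 - t 2), (t 2 - t 1) => m m0.
pose t' m := t m - (2 * t 1 - t 2 + (t 2 - t 1) * m%:~R).
suff: t' m = 0 by move/eqP; rewrite subr_eq0 => /eqP.
apply: (@affine_eq_eq0 t') => //; rewrite /t'; [|by ring|by ring].
move=> {m0} {}m n m0 n0 mn0; have E := tE m n m0 n0 mn0.
by apply: (lincomb1 (c := 1) E); ring.
Qed.

Lemma int_step_const (D : int -> K) :
  (forall k, D (k + 1) = D k) -> forall k, D k = D 0.
Proof.
move=> DS; elim/int_rect=> [//|n IH|n IH].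
- by rewrite -[RHS]IH -[RHS]DS; congr D; lia.
- by rewrite -[RHS]IH -[LHS]DS; congr D; lia.
Qed.

(** Solves the two-sided recursion by products.  It breaks at [k = 0] and
    [k = -1], so the positive and the negative half are normalised separately:
    [phi 1] and [phi (-1)] can be prescribed. *)
Lemma exists_gauge_seq (x : int -> K) (b : K) :
  (forall k : int, k != 0 -> k != -1 -> x k != 0) -> b != 0 ->
  exists phi : int -> K,
    [/\ phi 1 = 1, phi (-1) = b, forall k : int, k != 0 -> phi k != 0
      & forall k : int, k != 0 -> k != -1 -> x k * phi (k + 1) = - k%:~R * phi k].
Proof.
move=> x0 b0.
pose up := fix up n : K :=
  if n is n'.+1 then - n%:R * up n' / x n else 1.
pose dn := fix dn n : K :=
  if n is n'.+1 then x (- n.+1%:Z) * dn n' / n.+1%:R else b.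
exists (fun k => match k with Posz 0 => 0 | Posz n.+1 => up n | Negz n => dn n end).
have nat0 n : n.+1%:R != 0 :> K by rewrite pnatr_eq0.
have xp n : x n.+1 != 0 by apply: x0.
have xn n : x (- n.+2%:Z) != 0 by apply: x0; lia.
split=> //.
- case=> [[//|n] _|n _].
    elim: n => [|n IH] /=; first exact: oner_neq0.
    by rewrite mulf_neq0 ?invr_eq0 // mulf_neq0 // oppr_eq0.
  elim: n => [//|n IH] /=.
  by rewrite mulf_neq0 ?invr_eq0 // mulf_neq0.
- case=> [[//|n] _ _|[//|n] _ _].
    have -> : n.+1%:Z + 1 = n.+2 by lia.
    by rewrite /= mulrC divfK.
  have -> : Negz n.+1 + 1 = Negz n by lia.
  by rewrite NegzE rmorphN opprK [RHS]mulrC divfK.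
Qed.

(** * Witt algebra products with [f(k,0) = 0] *)
Section Gauged.
Variables (f : int -> int -> K) (phi : int -> K).
Hypothesis fL : forall m n k : int,
  (m - n)%:~R * f (m + n) k = f n k * f m (n + k) - f m k * f n (m + k).
Hypothesis f0 : forall k, f k 0 = 0.
Hypothesis phi0 : forall k : int, k != 0 -> phi k != 0.

(** In the rescaled basis [e_k = phi(k)^-1 d_k], left multiplication by [d_m]
    takes [e_k] to [- k e_{m+k}]: the action of vector fields on functions.  As
    [d_0] spans a subrepresentation, the coefficients [f m (- m)] escape this
    normal form, and [gauged] leaves them out. *)
Definition gauged_at m k := f m k * phi (m + k) = - k%:~R * phi k.
Definition gauged m := forall k : int, k != 0 -> m + k != 0 -> gauged_at m k.

(** An intermediate index [0] does no harm: then [f m 0 = 0], and the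
    coefficient [n + k] vanishes as well. *)
Lemma gauged_comp m n k : k != 0 -> m + n + k != 0 ->
  (n + k != 0 -> gauged_at n k) -> (n + k != 0 -> gauged_at m (n + k)) ->
  f n k * f m (n + k) * phi (m + n + k) = k%:~R * (n + k)%:~R * phi k.
Proof.
move=> k0 mnk0 En Em; have [nk0|nk0] := eqVneq (n + k) 0.
  by rewrite nk0 f0 !(mulr0, mul0r).
rewrite -addrA -mulrA Em // mulrCA En //; ring.
Qed.

Lemma gaugedD m n : m != n -> gauged m -> gauged n -> gauged (m + n).
Proof.
move=> mn Em En k k0 mnk0.
have mn0 : (m - n)%:~R != 0 :> K by rewrite intr_eq0 subr_eq0.
have nmk : n + m + k = m + n + k by ring.
apply: (mulfI mn0); rewrite mulrA fL mulrBl gauged_comp //; last 2 first.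
- by move=> nk0; apply: En.
- by move=> nk0; apply: Em; rewrite ?addrA.
rewrite -{1}nmk gauged_comp ?nmk //; first by ring.
- by move=> nk0; apply: Em.
- by move=> nk0; apply: En; rewrite ?addrA ?nmk.
Qed.

(** [d_2] is not generated by [d_1] and [d_{-1}].  Its action is pinned down by
    [[d_2, d_{-1}] = 3 d_1], inductively outwards from the indices [1] and [-3],
    where one term of the relation contains [f 2 0 = 0] or [f (-1) 0 = 0].  The
    index [-1] is reached from neither side, hence the last hypothesis. *)
Lemma gauged2 : gauged 1 -> gauged (-1) -> gauged_at 2 (-1) -> gauged 2.
Proof.
move=> E1 EN1 E2.
have fL2 k : 3 * f 1 k = f (-1) k * f 2 (-1 + k) - f 2 k * f (-1) (2 + k).
  exact: (fL 2 (-1) k).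
(* fL2 multiplied by phi (k + 1), which lets gauged 1 evaluate its left side *)
have R k : k != 0 -> k != -1 ->
    f (-1) k * f 2 (-1 + k) * phi (1 + k) -
    f 2 k * (f (-1) (2 + k) * phi (1 + k)) = - 3 * k%:~R * phi k.
  move=> k0 k1; rewrite [f 2 k * _]mulrA -mulrBl -fL2 -[LHS]mulrA E1 //; last by lia.
  by ring.
have S k : 2 + k != 0 -> 1 + k != 0 ->
    f (-1) (2 + k) * phi (1 + k) = - (2 + k)%:~R * phi (2 + k).
  move=> k2 k1; rewrite -EN1 //; last by lia.
  by congr (_ * phi _); lia.
have up k : 0 < k -> (k != 1 -> gauged_at 2 (-1 + k)) -> gauged_at 2 k.
  move=> k0 IH; rewrite /gauged_at.
  have C : f (-1) k * f 2 (-1 + k) * phi (1 + k) = k%:~R * (-1 + k)%:~R * phi k.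
    by apply: (@gauged_comp 2 (-1)) => [||h|h]; [lia|lia|apply: EN1; lia|apply: IH; lia].
  have kN0 : k != 0 by lia.
  have kN1 : k != -1 by lia.
  have := R k kN0 kN1; rewrite C S; [|by lia|by lia] => H.
  have k2 : (2 + k)%:~R != 0 :> K by rewrite intr_eq0; lia.
  apply: (mulfI k2).
  by apply: (lincomb1 (c := 1) H); ring.
have down k : k < -1 -> (k != -2 -> gauged_at 2 k) -> gauged_at 2 (-1 + k).
  move=> k0 IH; rewrite /gauged_at.
  have kk : k%:~R != 0 :> K by rewrite intr_eq0; lia.
  have C : f 2 k * (f (-1) (2 + k) * phi (1 + k)) = k%:~R * (2 + k)%:~R * phi k.
    rewrite mulrA; apply: (@gauged_comp (-1) 2) => [||h|h]; [lia|lia| |].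
      by apply: IH; lia.
    by apply: EN1; lia.
  have kN0 : k != 0 by lia.
  have kN1 : k != -1 by lia.
  have := R k kN0 kN1; rewrite C => H.
  have E : f (-1) k * phi (-1 + k) = - k%:~R * phi k by apply: EN1; lia.
  have pk : phi k != 0 by apply: phi0; lia.
  have -> : 2 + (-1 + k) = 1 + k by lia.
  apply: (mulfI (mulf_neq0 kk pk)).
  have H' : - (k%:~R * phi k) * (f 2 (-1 + k) * phi (1 + k)) =
     k%:~R * (-1 + k)%:~R * phi k * phi (-1 + k).
    rewrite -mulNr -E.
    by apply: (lincomb1 (c := phi (-1 + k)) H); ring.
  by apply: (lincomb1 (c := -1) H'); ring.
have upn (n : nat) : gauged_at 2 n.+1.
  by elim: n => [|n IH]; apply: up.
have dnn (n : nat) : gauged_at 2 (- n.+3%:Z).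
  elim: n => [|n IH]; first exact: (down (-2)).
  have -> : - n.+4%:Z = -1 + (- n.+3%:Z) by lia.
  by apply: down => //; lia.
by case=> [[|n]|[|[|n]]] // _ _; rewrite NegzE.
Qed.
End Gauged.

Section Witt.
Variables (f : int -> int -> K).
Hypothesis fC : forall m n : int, f m n - f n m = (m - n)%:~R.
Hypothesis fL : forall m n k : int,
  (m - n)%:~R * f (m + n) k = f n k * f m (n + k) - f m k * f n (m + k).
Hypothesis f0 : forall k : int, f k 0 = 0.

Lemma left_weight k : f 0 k = - k%:~R.
Proof. by have := fC 0 k; rewrite f0 subr0 sub0r rmorphN. Qed.

(** [[d_1, d_{-1}] = 2 d_0] makes the difference of the two sides constant in
    [k], and it vanishes at [k = 0]. *)
Lemma f1_fN1 k : f 1 k * f (-1) (1 + k) = k%:~R * (k + 1)%:~R.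
Proof.
pose D k := f 1 k * f (-1) (1 + k) - k%:~R * (k + 1)%:~R : K.
suff /int_step_const/(_ k) Dk : forall k, D (k + 1) = D k.
  have : D k = 0 by rewrite Dk /D f0; ring.
  by move/eqP; rewrite subr_eq0 => /eqP.
move=> {}k; rewrite /D; have := fL 1 (-1) (1 + k).
have -> : -1 + (1 + k) = k by lia.
rewrite [f (1 + -1) _]left_weight [1 + k]addrC mulrN [f (-1) _ * _]mulrC => E.
apply: (lincomb1 (c := 1) E); ring.
Qed.

Lemma f1_neq0 k : k != 0 -> k != -1 -> f 1 k != 0.
Proof.
move=> k0 k1; have : k%:~R * (k + 1)%:~R != 0 :> K.
  by rewrite mulf_neq0 // intr_eq0 //; lia.
by rewrite -f1_fN1 mulf_eq0 negb_or => /andP[].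
Qed.

(** This value makes the choice [phi (-1) = f 2 (-1)] legitimate and compatible
    with the action of [d_{-2}].  It follows from [[d_2, d_{-2}] = 4 d_0] once
    [f 2 1 * f (-2) 3] is known, and that product is obtained by multiplying two
    relations in which [f 2 0] and [f 1 0] vanish. *)
Lemma f2_fN2 : f 2 (-1) * f (-2) 1 = -1.
Proof.
have e1 : 3 * f 1 1 = f (-1) 1 * f 2 0 - f 2 1 * f (-1) 3 := fL 2 (-1) 1.
have e2 : 3 * f (-1) 2 = f (-2) 2 * f 1 0 - f 1 2 * f (-2) 3 := fL 1 (-2) 2.
have g1 : f 1 1 * f (-1) 2 = 1%:~R * 2%:~R := f1_fN1 1.
have g2 : f 1 2 * f (-1) 3 = 2%:~R * 3%:~R := f1_fN1 2.
have e3 : (2 - -2)%:~R * f 0 1 = f (-2) 1 * f 2 (-1) - f 2 1 * f (-2) 3.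
  exact: (fL 2 (-2) 1).
rewrite !f0 !mulr0 !sub0r in e1 e2; rewrite left_weight in e3.
have six : 6 != 0 :> K by rewrite pnatr_eq0.
have h : f 2 1 * f (-2) 3 = 3.
  apply: (mulfI six); rewrite mulrC.
  transitivity ((- (f 2 1 * f (-1) 3)) * (- (f 1 2 * f (-2) 3)) +
    f 2 1 * f (-2) 3 * (2%:~R * 3%:~R - f 1 2 * f (-1) 3)); first by ring.
  rewrite -e1 -e2 g2 subrr mulr0 addr0.
  transitivity (9 * (f 1 1 * f (-1) 2)); first by ring.
  by rewrite g1; ring.
rewrite h in e3; rewrite mulrC.
transitivity (f (-2) 1 * f 2 (-1) - 3 + 3); first by ring.
by rewrite -e3; ring.
Qed.

(** [d_{1}], [d_{-1}], [d_{2}], [d_{-2}] generate the Witt algebra through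
    brackets of distinct indices.  [d_{-2}] is handled by the reflection
    [k -> -k], which turns [f] into another solution. *)
Lemma exists_gauge : exists phi : int -> K,
  (forall k : int, k != 0 -> phi k != 0) /\ forall m, gauged f phi m.
Proof.
have b0 : f 2 (-1) != 0.
  by apply/eqP => b0; have /eqP := f2_fN2; rewrite b0 mul0r eq_sym oppr_eq0 oner_eq0.
have [phi [phi1 phiN1 phi0 phiS]] := exists_gauge_seq f1_neq0 b0.
exists phi; split=> //.
have E1 : gauged f phi 1.
  by move=> k k0 k1; rewrite /gauged_at addrC phiS //; lia.
have EN1 : gauged f phi (-1).
  move=> k k0 k1; rewrite /gauged_at; have := E1 (-1 + k); rewrite /gauged_at.
  have := f1_fN1 (-1 + k).
  have -> : 1 + (-1 + k) = k by lia.
  have -> : -1 + k + 1 = k by lia.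
  move=> e1 /(_ k1 k0) e2.
  have kk : (-1 + k)%:~R != 0 :> K by rewrite intr_eq0.
  apply: (mulfI kk).
  transitivity (- f (-1) k * (- (-1 + k)%:~R * phi (-1 + k))); first by ring.
  rewrite -e2; transitivity (- (f 1 (-1 + k) * f (-1) k) * phi k); first by ring.
  by rewrite e1; ring.
have E2 : gauged f phi 2.
  by apply: gauged2 => //; rewrite /gauged_at phi1 phiN1; ring.
pose f' (m n : int) := - f (- m) (- n); pose phi' (k : int) := phi (- k).
have mir n : gauged f' phi' n <-> gauged f phi (- n).
  split=> E k k0 k1.
    have := E (- k); rewrite /gauged_at /f' /phi' !opprK opprD opprK.
    move=> H; have {}H := H ltac:(lia) ltac:(lia).
    by apply: oppr_inj; rewrite -mulNr H; ring.
  have := E (- k); rewrite /gauged_at /f' /phi' opprD.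
  move=> H; have {}H := H ltac:(lia) ltac:(lia).
  by rewrite mulNr H; ring.
have EN2 : gauged f phi (-2).
  apply/(mir 2); apply: gauged2.
  - move=> a b c; rewrite /f' !opprD mulrNN mulrNN -fL; ring.
  - by move=> k; rewrite /f' oppr0 f0 oppr0.
  - by move=> k k0; apply: phi0; lia.
  - exact/(mir 1).
  - exact/(mir (-1)).
  rewrite /gauged_at /f' /phi' phi1 phiN1 mulNr mulrC f2_fN2; ring.
have pos (n : nat) : gauged f phi n.
  elim: n => [|[|[|n]] IH] //.
    by move=> k k0 k1; rewrite /gauged_at left_weight add0r.
  have -> : n.+3%:Z = n.+2%:Z + 1 by lia.
  by apply: gaugedD.
have neg (n : nat) : gauged f phi (- n%:Z).
  elim: n => [|[|[|n]] IH] //; first exact: (pos 0).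
  have -> : - n.+3%:Z = - n.+2%:Z + (- 1) by lia.
  by apply: gaugedD => //; lia.
by case=> n //; rewrite NegzE.
Qed.

(** Both [f(m,-m)] and the central term satisfy the identity assumed for [A].
    Dividing by [m (u - v m)], its shape for the expected solution, leaves the
    functional equation of [affine_of_eq]. *)
Lemma cocycle_affine (u v : K) (A : int -> K) :
  (forall k : int, k != 0 -> u + v * k%:~R != 0) ->
  (forall m k : int, k != 0 -> m + k != 0 ->
     f m k * (u + v * (m + k)%:~R) = - k%:~R * (u + v * k%:~R)) ->
  (forall m n : int, (m - n)%:~R * A (m + n) =
     f n (- (m + n)) * A m - f m (- (m + n)) * A n) ->
  exists s t, forall m : int, m != 0 ->
    A m = m%:~R * (u - v * m%:~R) * (s + t * m%:~R).
Proof.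
move=> D0 fD AL.
have DN0 (k : int) : k != 0 -> u - v * k%:~R != 0.
  by move=> k0; have := D0 (- k); rewrite rmorphN mulrN; apply; lia.
pose B (m : int) := A m / (m%:~R * (u - v * m%:~R)).
have AB (m : int) : m != 0 -> A m = m%:~R * (u - v * m%:~R) * B m.
  move=> m0; rewrite mulrC divfK // mulf_neq0 ?DN0 ?intr_eq0 //.
have [m n m0 n0 mn0|s [t BE]] := affine_of_eq (t := B); last first.
  by exists s, t => m m0; rewrite AB ?BE.
have F a b : a != 0 -> a + b != 0 ->
    f b (- (a + b)) * (u - v * a%:~R) =
    (a + b)%:~R * (u - v * (a + b)%:~R).
  move=> a0 ab0; have := fD b (- (a + b)).
  have -> : b + - (a + b) = - a by lia.
  rewrite !rmorphN !mulrN opprK; apply; lia.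
have := AL m n; rewrite !AB // => E.
have Fm := F m n m0 mn0; have := F n m n0; rewrite addrC => /(_ mn0) Fn.
have mnD : (m + n)%:~R * (u - v * (m + n)%:~R) != 0.
  by rewrite mulf_neq0 ?DN0 ?intr_eq0.
apply: (mulfI mnD).
have {}E : (m - n)%:~R * ((m + n)%:~R * (u - v * (m + n)%:~R) * B (m + n)) =
  m%:~R * B m * (f n (- (m + n)) * (u - v * m%:~R)) -
  n%:~R * B n * (f m (- (m + n)) * (u - v * n%:~R)) by rewrite E; ring.
rewrite Fm Fn in E; apply: (lincomb1 (c := -1) E); ring.
Qed.

(** The scale [u] in [phi = u + v k] is nonzero because the bracket forces
    [u * s = 1], so [eps = v / u]; the extra parameter [t] of [f(m,-m)] survives
    only if [eps = 0]. *)
Lemma witt_form : exists eps t : K,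
  [/\ eps * t = 0, forall k : int, 1 + eps * k%:~R != 0,
      forall m k : int, m + k != 0 ->
        f m k = - (k%:~R * (1 + eps * k%:~R) / (1 + eps * (m + k)%:~R))
    & forall m : int, f m (- m) = m%:~R * (1 - eps * m%:~R) * (1 + t * m%:~R)].
Proof.
have [phi [phi0 phiE]] := exists_gauge.
have [m k m0 k0 mk0|u [v phiA]] := affine_of_eq (t := phi).
  have e1 := phiE m k k0 mk0; have e3 := fC m k.
  have e2 : f k m * phi (m + k) = - m%:~R * phi m.
    by rewrite addrC; apply: phiE; rewrite ?(addrC k).
  rewrite -e3 mulrBl e1 e2; ring.
have D0 (k : int) : k != 0 -> u + v * k%:~R != 0.
  by move=> k0; rewrite -phiA ?phi0.
have fD (m k : int) : k != 0 -> m + k != 0 ->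
     f m k * (u + v * (m + k)%:~R) = - k%:~R * (u + v * k%:~R).
  by move=> k0 mk0; rewrite -!phiA ?phiE.
have [m n|s [t fN]] := cocycle_affine (A := fun m => f m (- m)) D0 fD.
  rewrite (fL m n); congr (_ * f m _ - _ * f n _); lia.
have st (m : int) : m != 0 -> u * s - v * t * (m%:~R * m%:~R) = 1.
  move=> m0; have mN0 : - m != 0 by lia.
  have mm : 2 * m%:~R != 0 :> K by rewrite mulf_neq0 ?intr_eq0 ?pnatr_eq0.
  have := fC m (- m); have := fN _ mN0; rewrite opprK => ->; rewrite fN // => E.
  apply: (mulfI mm); apply: (lincomb1 (c := 1) E); ring.
have st1 := st 1 isT; have st2 := st 2 isT.
have three : 3 != 0 :> K by rewrite pnatr_eq0.
have vt : v * t = 0.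
  by apply: (mulfI three); apply: (lincomb2 (c := 1) (c' := -1) st1 st2); ring.
have us : u * s = 1 by move: st1; rewrite vt mul0r subr0.
have u0 : u != 0 by apply/eqP => u0; move/eqP: us; rewrite u0 mul0r eq_sym oner_eq0.
have DE (k : int) : u + v * k%:~R = u * (1 + v / u * k%:~R) by field.
exists (v / u), (u * t); split.
- by rewrite mulrA divfK.
- move=> k; have [->|k0] := eqVneq k 0; first by rewrite mulr0 addr0 oner_eq0.
  by have := D0 k k0; rewrite DE mulf_eq0 negb_or => /andP[].
- move=> m k mk0; have [->|k0] := eqVneq k 0; first by rewrite f0 !mul0r oppr0.
  have := fD m k k0 mk0; have := D0 _ mk0; rewrite !DE mulf_eq0 negb_or.
  move=> /andP[_ h] E; apply: (mulIf h); apply: (mulfI u0).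
  rewrite mulNr divfK //; apply: (lincomb1 (c := 1) E); ring.
- move=> m; have [->|m0] := eqVneq m 0; first by rewrite f0 !mul0r.
  rewrite fN //; have s1 : s = u^-1 by apply: (mulfI u0); rewrite us divff.
  by rewrite s1; field.
Qed.

End Witt.

(** * The central extension *)
(** The part of [S = {k >= 0}] or [S = {k >= -1}] that the contradiction in
    [no_half_line] uses. *)
Definition half_line (S : int -> bool) :=
  [&& S 1, S 3, ~~ S (-2), ~~ S (-3), ~~ S (-5) & ~~ S (-6)].

(** The hypothesis says that [S] and its complement are closed under sums of
    distinct elements.  Up to sign such an [S] is all of Z, [{k >= 0}] or
    [{k >= -1}]; finitely many instances settle the indices that matter. *)
Lemma int_bipartition (S : int -> bool) :
  S 0 -> (forall m n : int, m != n -> S m = S n -> S (m + n) = S m) ->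
  [|| [&& S 2, S (-2), S 3 & S (-3)], half_line S
    | half_line (fun k => S (- k))].
Proof.
move=> S0 SD; have D m n : m != n -> (S m == S n) ==> (S (m + n) == S m).
  by move=> mn; apply/implyP => /eqP e; apply/eqP; apply: SD.
have D1 : (S 1 == S (-1)) ==> (S 0 == S 1) := D 1 (-1) isT.
have D2 : (S 2 == S (-2)) ==> (S 0 == S 2) := D 2 (-2) isT.
have D3 : (S 3 == S (-3)) ==> (S 0 == S 3) := D 3 (-3) isT.
have P1 : (S 2 == S (-1)) ==> (S 1 == S 2) := D 2 (-1) isT.
have N1 : (S (-2) == S 1) ==> (S (-1) == S (-2)) := D (-2) 1 isT.
have P2 : (S 1 == S 2) ==> (S 3 == S 1) := D 1 2 isT.
have N2 : (S (-1) == S (-2)) ==> (S (-3) == S (-1)) := D (-1) (-2) isT.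
have P3 : (S 3 == S (-1)) ==> (S 2 == S 3) := D 3 (-1) isT.
have N3 : (S (-3) == S 1) ==> (S (-2) == S (-3)) := D (-3) 1 isT.
have P4 : (S 2 == S 3) ==> (S 5 == S 2) := D 2 3 isT.
have N4 : (S (-2) == S (-3)) ==> (S (-5) == S (-2)) := D (-2) (-3) isT.
have P5 : (S 6 == S (-1)) ==> (S 5 == S 6) := D 6 (-1) isT.
have N5 : (S (-6) == S 1) ==> (S (-5) == S (-6)) := D (-6) 1 isT.
have P6 : (S 5 == S 1) ==> (S 6 == S 5) := D 5 1 isT.
have N6 : (S (-5) == S (-1)) ==> (S (-6) == S (-5)) := D (-5) (-1) isT.
have P7 : (S 6 == S (-3)) ==> (S 3 == S 6) := D 6 (-3) isT.
have N7 : (S (-6) == S 3) ==> (S (-3) == S (-6)) := D (-6) 3 isT.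
move: S0 D1 D2 D3 P1 N1 P2 N2 P3 N3 P4 N4 P5 N5 P6 N6 P7 N7 {D SD}.
rewrite /half_line !opprK => ->.
by case: (S 1); case: (S (-1)) => //; case: (S 2); case: (S (-2)) => //;
   case: (S 3); case: (S (-3)) => //; case: (S 5); case: (S (-5)) => //;
   case: (S 6); case: (S (-6)).
Qed.

Section Graded.
Variable f : int -> int -> K.
Hypothesis fC : forall m n : int, f m n - f n m = (m - n)%:~R.
Hypothesis fL : forall m n k : int,
  (m - n)%:~R * f (m + n) k = f n k * f m (n + k) - f m k * f n (m + k).

(** Once [f 0 j] is written [f j 0 - j], the representation identity for
    [d_m, d_0, d_k] is [f m k] times the conclusion. *)
Lemma weight_invariant m k : f m k != 0 -> f (m + k) 0 = f k 0.
Proof.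
move=> fmk; apply: (mulfI fmk).
have e1 := fC 0 (m + k); have e2 := fC 0 k.
have e3 : m%:~R * f m k = f 0 k * f m k - f m k * f 0 (m + k).
  by have := fL m 0 k; rewrite add0r ?addr0 ?subr0.
have e4 : f 0 (m + k) = f (m + k) 0 - (m%:~R + k%:~R).
  by apply: (lincomb1 (c := 1) e1); ring.
have e5 : f 0 k = f k 0 - k%:~R by apply: (lincomb1 (c := 1) e2); ring.
by rewrite e4 e5 in e3; apply: (lincomb1 (c := 1) e3); ring.
Qed.

Definition charged k := f k 0 != 0.

Lemma weight_neq_eq0 m k : charged (m + k) != charged k -> f m k = 0.
Proof. by apply: contraNeq => /weight_invariant; rewrite /charged => ->. Qed.

(** [f m n] and [f n m] differ by [m - n], so one of them is nonzero and
    [weight_invariant] applies to it. *)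
Lemma chargedD m n : m != n -> charged m = charged n -> charged (m + n) = charged m.
Proof.
move=> mn e; have [h|] := eqVneq (charged (m + n)) (charged m) => // h.
have := fC m n; rewrite weight_neq_eq0 -?e // weight_neq_eq0; last by rewrite addrC.
by move/eqP; rewrite subrr eq_sym intr_eq0 subr_eq0 (negPf mn).
Qed.

(** When exactly one of [m], [k] is charged, [d_m d_k] is [[d_m, d_k]] if [m + k]
    is charged like [k], and [0] otherwise.  This computes [f 3 3] from [d_{-5}]
    as [- 40 / 11] and from [d_{-6}] as [- 9 / 2]. *)
Lemma no_half_line : charged 0 -> ~~ half_line charged.
Proof.
move=> S0; apply/negP => /and5P[S1 S3 /negPf S2 /negPf SN3 /andP[/negPf S5 /negPf S6]].
have mix m k : charged (k + m) != charged m -> f m k = (m - k)%:~R.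
  by move=> h; rewrite -fC (weight_neq_eq0 (m := k)) ?subr0.
have e1 : (3 - -5)%:~R * f (-2) 3 = f (-5) 3 * f 3 (-2) - f 3 3 * f (-5) 6.
  exact: (fL 3 (-5) 3).
have e2 : (3 - -6)%:~R * f (-3) 3 = f (-6) 3 * f 3 (-3) - f 3 3 * f (-6) 6.
  exact: (fL 3 (-6) 3).
have a1 : f (-2) 3 = (-2 - 3)%:~R.
  by apply: mix; rewrite (S1 : charged (3 + -2)) S2.
have a2 : f (-5) 3 = 0 by apply: weight_neq_eq0; rewrite (S2 : charged (-5 + 3) = _) S3.
have a3 : f (-5) 6 = (-5 - 6)%:~R.
  by apply: mix; rewrite (S1 : charged (6 + -5)) S5.
have b1 : f (-3) 3 = (-3 - 3)%:~R.
  by apply: mix; rewrite (S0 : charged (3 + -3)) SN3.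
have b2 : f (-6) 3 = 0 by apply: weight_neq_eq0; rewrite (SN3 : charged (-6 + 3) = _) S3.
have b3 : f (-6) 6 = (-6 - 6)%:~R.
  by apply: mix; rewrite (S0 : charged (6 + -6)) S6.
rewrite a1 a2 a3 mul0r in e1; rewrite b1 b2 b3 mul0r in e2.
have : 114%:R = 0 :> K.
  by apply: (lincomb2 (c := 12) (c' := -11) e1 e2); ring.
by move/eqP; rewrite pnatr_eq0.
Qed.
End Graded.

Section Virasoro.
Variables f w : int -> int -> K.
Hypothesis fC : forall m n : int, f m n - f n m = (m - n)%:~R.
Hypothesis fL : forall m n k : int,
  (m - n)%:~R * f (m + n) k = f n k * f m (n + k) - f m k * f n (m + k).
Hypothesis wC : forall m n : int,
  w m n - w n m = (m ^+ 3 - m)%:~R / 12 * (m + n == 0)%:R.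
Hypothesis wL : forall m n k : int,
  (m - n)%:~R * w (m + n) k = f n k * w m (n + k) - f m k * w n (m + k).

Lemma omega_left0 m k : (m%:~R - f 0 k) * w m k = - (f m k * w 0 (m + k)).
Proof.
have e : m%:~R * w m k = f 0 k * w m k - f m k * w 0 (m + k).
  by have := wL m 0 k; rewrite add0r ?addr0 ?subr0.
by rewrite mulrBl e; ring.
Qed.

(** Otherwise [f 0 0 <> 0] and [int_bipartition] applies.  If [2], [-2], [3] and
    [-3] are all charged, the central cocycle evaluated there gives
    [f 0 0 * (j^3 - j) / 12 = 2 j * w 0 0] for [j = 2] and [j = 3], which is
    inconsistent. *)
Lemma right_weight_eq0 k : f k 0 = 0.
Proof.
apply/eqP/negPn/negP => fk0.
have cE j : charged f j -> f j 0 = f 0 0.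
  by move=> /(weight_invariant fC fL); rewrite addr0.
have S0 : charged f 0 by rewrite /charged -(cE k).
have /or3P[] := int_bipartition S0 (chargedD fC fL).
- case/and4P => P2 N2 P3 N3.
  have cocycle (j : int) : charged f j -> charged f (- j) ->
      f 0 0 * ((j ^+ 3 - j)%:~R / 12) = 2 * j%:~R * w 0 0.
    move=> jP jN; have d (i : int) : charged f i ->
        f 0 0 * w (- i) i = f (- i) i * w 0 0.
      move=> iP; have := omega_left0 (- i) i; have := fC 0 i; rewrite cE // addNr => e1 e2.
      apply: (lincomb2 (c := -1) (c' := - w (- i) i) e2 e1); ring.
    have d1 := d _ jP; have := d _ jN; rewrite opprK => d2.
    have := wC j (- j); rewrite subrr eqxx mulr1 => d3.
    have d4 := fC j (- j).
    rewrite -d3 mulrBr d1 d2 -mulrBl d4; ring.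
  have c2 := cocycle _ P2 N2; have c3 := cocycle _ P3 N3.
  move/eqP: S0; apply; have n30 : 30 != 0 :> K by rewrite pnatr_eq0.
  apply: (mulfI n30).
  have n12 : 12 != 0 :> K by rewrite pnatr_eq0.
  have c2' : f 0 0 * 6 = 2 * 2%:~R * w 0 0 * 12.
    by rewrite -c2 mulrA divfK.
  have c3' : f 0 0 * 24 = 2 * 3%:~R * w 0 0 * 12.
    by rewrite -c3 mulrA divfK.
  apply: (lincomb2 (c := -3) (c' := 2) c2' c3'); ring.
- by apply/negP/no_half_line.
- pose f' (m n : int) := - f (- m) (- n).
  have SE j : charged f' j = charged f (- j) by rewrite /charged /f' oppr0 oppr_eq0.
  have fC' m n : f' m n - f' n m = (m - n)%:~R.
    by rewrite /f'; apply: (lincomb1 (c := -1) (fC (- m) (- n))); ring.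
  have fL' m n j :
     (m - n)%:~R * f' (m + n) j = f' n j * f' m (n + j) - f' m j * f' n (m + j).
    by rewrite /f' !opprD; apply: (lincomb1 (c := 1) (fL (- m) (- n) (- j))); ring.
  have := no_half_line fC' fL'; rewrite SE oppr0 => /(_ S0) /negP h.
  by rewrite /half_line -!SE.
Qed.

Lemma omega_off_diag m k : m + k != 0 -> w m k = 0.
Proof.
move=> mk0; have W j : j != 0 -> w 0 j = 0.
  move=> j0; have jj : j%:~R != 0 :> K by rewrite intr_eq0.
  have e1 : j%:~R * w j 0 = 0.
    by have := omega_left0 j 0; rewrite !right_weight_eq0 subr0 mul0r oppr0.
  have e2 := wC j 0; apply: (mulfI jj).
  rewrite addr0 (negPf j0) mulr0 in e2.
  apply: (lincomb2 (c := 1) (c' := - j%:~R) e1 e2); ring.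
have mk : (m + k)%:~R != 0 :> K by rewrite intr_eq0.
apply: (mulfI mk); have := omega_left0 m k; rewrite W // (left_weight fC right_weight_eq0) => e.
by apply: (lincomb1 (c := 1) e); ring.
Qed.

Lemma omega00 : w 0 0 = 0.
Proof.
have d (i : int) : f (- i) i * w 0 0 = 0.
  have := omega_left0 (- i) i; rewrite (left_weight fC right_weight_eq0) addNr => e.
  by apply: (lincomb1 (c := 1) e); ring.
have d1 := d 1; have dN1 := d (-1); rewrite opprK in dN1.
have two : 2 != 0 :> K by rewrite pnatr_eq0.
apply: (mulfI two).
have -> : 2 = f 1 (-1) - f (-1) 1 by rewrite fC.
by rewrite mulr0 mulrBl dN1 d1 subrr.
Qed.

(** If [eps = 0], the cocycle identity at [(2, -1)] and [(-2, 1)] forces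
    [w(2,-2) = w(-2,2)], against the bracket.  If not, [w(m,-m)] is
    [m (1 - eps m) (s + u m)] and the bracket at [m = 1] and [m = 2] yields
    [s = - 1 / 24] and [u = s / eps]. *)
Theorem virasoro_form : exists eps : K,
  [/\ eps != 0, forall k : int, 1 + eps * k%:~R != 0,
      forall m n : int,
        f m n = - (n%:~R * (1 + eps * n%:~R) / (1 + eps * (m + n)%:~R))
    & forall m n : int,
        w m n = 24^-1 * ((m ^+ 3 - m)%:~R + (eps - eps^-1) * (m ^+ 2)%:~R)
                  * (m + n == 0)%:R].
Proof.
have [eps [t [et0 D0 fE fN]]] := witt_form fC fL right_weight_eq0.
pose W m := w m (- m).
have WC (m : int) : W m - W (- m) = (m ^+ 3 - m)%:~R / 12.
  by rewrite /W opprK wC subrr eqxx mulr1.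
have WL (m n : int) : (m - n)%:~R * W (m + n) =
     f n (- (m + n)) * W m - f m (- (m + n)) * W n.
  by rewrite /W wL; congr (_ * w m _ - _ * w n _); lia.
have D1 (k : int) : k != 0 -> 1 + eps * k%:~R != 0 by [].
have fD (m k : int) : k != 0 -> m + k != 0 ->
    f m k * (1 + eps * (m + k)%:~R) = - k%:~R * (1 + eps * k%:~R).
  by move=> _ mk0; rewrite fE // mulNr divfK // mulNr.
have [s [u WE]] := cocycle_affine D1 fD WL.
have eps0 : eps != 0.
  apply/eqP => eps0; have fE0 m k : m + k != 0 -> f m k = - k%:~R.
    by move=> mk0; rewrite fE // eps0 !mul0r addr0 divr1 mulr1.
  have := WL 2 (-1); have := WL (-2) 1; have := WC 1; have := WC 2.
  rewrite !fE0 // => d2 d1 l1 l2.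
  have l1' : (-3)%:~R * W (-1) = - 1%:~R * W (-2) - - 1%:~R * W 1 := l1.
  have l2' : 3%:~R * W 1 = - (-1)%:~R * W 2 - - (-1)%:~R * W (-1) := l2.
  have {}l1 : W (-2) = 3 * W (-1) + W 1.
    by apply: (lincomb1 (c := 1) l1'); ring.
  have {}l2 : W 2 = 3 * W 1 + W (-1).
    by apply: (lincomb1 (c := -1) l2'); ring.
  have : 6 / 12 = 0 :> K.
    by rewrite l1 l2 in d2; apply: (lincomb2 (c := -1) (c' := 2) d2 d1); ring.
  by move/eqP; rewrite mulf_eq0 invr_eq0 !pnatr_eq0.
have t0 : t = 0 by apply: (mulfI eps0); rewrite et0 mulr0.
have e1 := WC 1; have e2 := WC 2; rewrite !WE // in e1 e2.
have n12 : 12 != 0 :> K by rewrite pnatr_eq0.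
have s24 : s = - 24^-1.
  by apply: (mulfI n12); apply: (lincomb2 (c := 8) (c' := -1) e1 e2); field.
have u24 : eps * u = - 24^-1.
  by apply: (mulfI n12); apply: (lincomb2 (c := 2) (c' := -1) e1 e2); field.
have uE : u = - 24^-1 / eps by apply: (mulfI eps0); rewrite u24; field; rewrite ?eps0.
exists eps; split=> // m n; last first.
  have [mn0|mn0] := eqVneq (m + n) 0; last by rewrite omega_off_diag // mulr0.
  have -> : n = - m by lia.
  have [->|m0] := eqVneq m 0; first by rewrite oppr0 omega00; ring.
  by rewrite mulr1 -[LHS]/(W m) WE // s24 uE; field.
have [mn0|mn0] := eqVneq (m + n) 0; last by rewrite fE.
have -> : n = - m by lia.
by rewrite fN t0 subrr mulr0 addr0 divr1; ring.
Qed.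
End Virasoro.

(** * The action on the twisted Heisenberg part *)
Section Heisenberg.
Variables f g h a b rho : int -> int -> K.
Let half (n : int) : K := n%:~R + 2^-1.
Hypothesis f0 : forall k : int, f 0 k = - k%:~R.
Hypothesis f11 : f 1 1 + f (-1) (-1) != 0.
Hypothesis ghC : forall m n : int, g m n - h n m = - half n.
Hypothesis rhoC : forall m n : int,
  rho m n - rho n m = half m * (m + n + 1 == 0)%:R.
Hypothesis hL : forall m n k : int,
  - half n * h (m + n) k = h n k * g m (n + k) - f m k * h n (m + k).
Hypothesis aL : forall m n k : int,
  - half n * a (m + n) k = a n k * f m (n + k) - g m k * a n (m + k).
Hypothesis bL : forall m n k : int,
  - half n * b (m + n) k = b n k * g m (n + k) - g m k * b n (m + k).
Hypothesis rhoL : forall m n k : int,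
  - half n * rho (m + n) k = - (g m k * rho n (m + k)).

Lemma half_neq0 n : half n != 0.
Proof.
have two : 2 != 0 :> K by rewrite pnatr_eq0.
apply/eqP => h0; have : (2 * n + 1)%:~R = 0 :> K.
  transitivity (2 * half n); last by rewrite h0 mulr0.
  by rewrite /half; field.
by move/eqP; rewrite intr_eq0; lia.
Qed.

Lemma halfN n : half (- n - 1) = - half n.
Proof. by rewrite /half; field. Qed.

(** [rho(-r, r)] divided by [- r], for [r = n + 1/2]. *)
Let T n := - (rho (- n - 1) n / half n).

Lemma TE n : rho (- n - 1) n = - half n * T n.
Proof. by rewrite /T mulNr mulrN opprK mulrC divfK ?half_neq0. Qed.

Lemma gT m k : g m k * (half (m + k) * T (m + k)) = - half (m + k) * (half k * T k).
Proof.
have := rhoL m (- (m + k) - 1) k; rewrite halfN TE.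
have -> : m + (- (m + k) - 1) = - k - 1 by lia.
rewrite TE => E; apply: (lincomb1 (c := -1) E); ring.
Qed.

(** The bracket [[h_r, h_{-r}] = r l]. *)
Lemma TN n : T n + T (- n - 1) = 1.
Proof.
have := rhoC (- n - 1) n; rewrite TE.
have -> : - n - 1 + n + 1 == 0 by lia.
have := TE (- n - 1); have -> : - (- n - 1) - 1 = n by lia.
rewrite halfN mulr1 => -> E; apply: (mulfI (half_neq0 n)).
by apply: (lincomb1 (c := -1) E); ring.
Qed.

(** By [gT] a zero of [T] would spread to all indices, against [TN]. *)
Lemma T_neq0 n : T n != 0.
Proof.
have prop p q : T p = 0 -> T q = 0.
  move=> p0; have := gT (p - q) q; rewrite subrK p0 !mulr0 => /esym/eqP.
  by rewrite !mulf_eq0 oppr_eq0 !(negPf (half_neq0 _)) => /eqP.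
apply/eqP => n0; have := TN n; rewrite n0 (prop n (- n - 1)) // addr0 => /eqP.
by rewrite eq_sym oner_eq0.
Qed.

Lemma gE m k : g m k = - (half k * T k / T (m + k)).
Proof.
have nz : half (m + k) * T (m + k) != 0 by rewrite mulf_neq0 ?half_neq0 ?T_neq0.
apply: (mulIf nz); rewrite gT; field; exact: T_neq0.
Qed.

Lemma hE n k : h n k = half n * (1 - T n / T (n + k)).
Proof.
have := ghC k n; rewrite gE addrC => e.
by apply: (lincomb1 (c := -1) e); rewrite (addrC k n); ring.
Qed.

(** The identity for [d_m, h_n, d_k] after substituting [gE] and [hE] and
    cancelling the common factor. *)
Lemma TL m n k :
  half (m + n) * (T (m + n + k) - T (m + n)) =
  half (n + k) * (T (n + k) - T n) + f m k * (T (m + n + k) - T n).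
Proof.
have := hL m n k; rewrite !hE gE addrA.
have -> : n + (m + k) = m + n + k by lia.
move=> e; have h0 := half_neq0 n; have T1 := T_neq0 (m + n + k).
have T2 := T_neq0 (n + k).
have e' : half n / T (m + n + k) *
  (half (m + n) * (T (m + n + k) - T (m + n))) =
  half n / T (m + n + k) *
  (half (n + k) * (T (n + k) - T n) + f m k * (T (m + n + k) - T n)).
  by apply: (lincomb1 (c := -1) e); field; rewrite T1 T2.
have nz : half n / T (m + n + k) != 0 by rewrite mulf_neq0 ?invr_eq0.
exact: (mulfI nz).
Qed.

(** [TL] for [m = k = 1] at [n] and for [m = k = -1] at [n + 2] contain the same
    terms in [half]; their difference gives [T (n + 2) = T n] by the hypothesis
    on [f], and then either of them gives [T (n + 1) = T n]. *)
Lemma T_half n : T n = 2^-1.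
Proof.
have step k : T (k + 1) = T k.
  have e1 := TL 1 k 1; have e2 := TL (-1) (k + 2) (-1).
  have r1 : 1 + k = k + 1 by lia. have r2 : k + 1 + 1 = k + 2 by lia.
  have r3 : -1 + (k + 2) = k + 1 by lia. have r4 : k + 2 + -1 = k + 1 by lia.
  have r5 : k + 1 + -1 = k by lia.
  rewrite r1 r2 in e1; rewrite r3 r4 r5 in e2.
  have e3 : T (k + 2) = T k.
    apply: (mulfI f11); apply: (lincomb2 (c := -1) (c' := 1) e1 e2); ring.
  have nz : 2 * half (k + 1) != 0 by rewrite mulf_neq0 ?half_neq0 ?pnatr_eq0.
  apply: (mulfI nz); rewrite e3 in e1; apply: (lincomb1 (c := -1) e1); ring.
have two : 2 != 0 :> K by rewrite pnatr_eq0.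
have := TN n; rewrite !(int_step_const step) => e.
apply: (mulfI two); rewrite divff //; apply: (lincomb1 (c := 1) e); ring.
Qed.

(** Left multiplication by [d_0] acts by minus the degree, so [a] and [b] vanish:
    [h_{m+1/2} h_{n+1/2}] has degree [m + n + 1], while [d_{m+n}] and
    [h_{m+n+1/2}] have degrees [m + n] and [m + n + 1/2]. *)
Theorem heisenberg_form :
  [/\ forall m n : int, g m n = - half n,
      forall m n : int, h m n = 0,
      forall m n : int, a m n = 0,
      forall m n : int, b m n = 0
    & forall m n : int, rho m n = 2^-1 * half m * (m + n + 1 == 0)%:R].
Proof.
have two : 2 != 0 :> K by rewrite pnatr_eq0.
have gh m n : g m n = - half n by rewrite gE !T_half mulfK ?invr_eq0.
split=> // m n.
- by rewrite hE !T_half divff ?invr_eq0 // subrr mulr0.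
- have := aL 0 m n; rewrite f0 gh !add0r => e.
  by apply: (lincomb1 (c := -1) e); rewrite /half; field.
- have := bL 0 m n; rewrite !gh !add0r => e.
  by apply: (mulfI two); apply: (lincomb1 (c := -4) e); rewrite /half; field.
- have [mn|mn] := eqVneq (m + n + 1) 0.
    have -> : m = - n - 1 by lia.
    by rewrite TE T_half halfN mulr1; ring.
  have mn0 : (m + n + 1)%:~R != 0 :> K by rewrite intr_eq0.
  have := rhoL 0 m n; rewrite gh !add0r mulr0 => e; apply: (mulfI mn0).
  by apply: (lincomb1 (c := -1) e); rewrite /half; field.
Qed.
End Heisenberg.

End Scalars.

(** * From products to structure functions *)
(** The argument only compares coordinates along the vectors [vd], [vh], [vc],
    [vl], so any module with dual linear forms will do. *)
Section GradedProduct.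
Variables (K : numFieldType) (V : lmodType K) (mul : {bilinear V -> V -> V}).
Variables (vd vh : int -> V) (vc vl : V).
Variables (xd xh : int -> {scalar V}) (xc xl : {scalar V}).
Variables f g h a b w rho : int -> int -> K.
Let half (n : int) : K := n%:~R + 2^-1.

Hypothesis xdE : forall m n : int,
  [/\ xd m (vd m) = 1, xd m (vh n) = 0, xd m vc = 0 & xd m vl = 0].
Hypothesis xhE : forall m n : int,
  [/\ xh m (vd n) = 0, xh m (vh m) = 1, xh m vc = 0 & xh m vl = 0].
Hypothesis xcE : forall m n : int,
  [/\ xc (vd m) = 0, xc (vh n) = 0, xc vc = 1 & xc vl = 0].
Hypothesis xlE : forall m n : int,
  [/\ xl (vd m) = 0, xl (vh n) = 0, xl vc = 0 & xl vl = 1].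

Hypothesis mulL : forall x y z : V,
  mul (mul x y) z - mul x (mul y z) = mul (mul y x) z - mul y (mul x z).
Hypothesis brdd : forall m n : int,
  mul (vd m) (vd n) - mul (vd n) (vd m) =
  (m - n)%:~R *: vd (m + n)
  + ((m ^+ 3 - m)%:~R / 12 * (m + n == 0)%:R) *: vc.
Hypothesis brdh : forall m n : int,
  mul (vd m) (vh n) - mul (vh n) (vd m) = - half n *: vh (m + n).
Hypothesis brhh : forall m n : int,
  mul (vh m) (vh n) - mul (vh n) (vh m) =
  (half m * (m + n + 1 == 0)%:R) *: vl.

Hypothesis mdd : forall m n : int,
  mul (vd m) (vd n) = f m n *: vd (m + n) + w m n *: vc.
Hypothesis mdh : forall m n : int, mul (vd m) (vh n) = g m n *: vh (m + n).
Hypothesis mhd : forall m n : int, mul (vh m) (vd n) = h m n *: vh (m + n).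
Hypothesis mhh : forall m n : int, mul (vh m) (vh n) =
  a m n *: vd (m + n) + b m n *: vh (m + n) + rho m n *: vl.
Hypothesis mdc : forall m : int, mul (vd m) vc = 0.
Hypothesis mcd : forall m : int, mul vc (vd m) = 0.
Hypothesis mdl : forall m : int, mul (vd m) vl = 0.
Hypothesis mhc : forall m : int, mul (vh m) vc = 0.

(** Left-symmetry, regrouped: left multiplication represents the bracket. *)
Lemma mul_rep x y z :
  mul (mul x y - mul y x) z = mul x (mul y z) - mul y (mul x z).
Proof.
rewrite linearBl; have /eqP := mulL x y z; rewrite subr_eq => /eqP ->.
by rewrite addrAC [X in X - _ + _]addrC addrK addrC.
Qed.

Let expand := (linearDl, linearDr, linearZl_LR, linearZr_LR).
Let table := (mdd, mdh, mhd, mhh, mdc, mcd, mdl, mhc).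

Lemma xdP m n :
  ((xd m (vd m) = 1) * (xd m (vh n) = 0) * (xd m vc = 0) * (xd m vl = 0))%type.
Proof. by case: (xdE m n). Qed.
Lemma xhP m n :
  ((xh m (vd n) = 0) * (xh m (vh m) = 1) * (xh m vc = 0) * (xh m vl = 0))%type.
Proof. by case: (xhE m n). Qed.
Lemma xcP m n :
  ((xc (vd m) = 0) * (xc (vh n) = 0) * (xc vc = 1) * (xc vl = 0))%type.
Proof. by case: (xcE m n). Qed.
Lemma xlP m n :
  ((xl (vd m) = 0) * (xl (vh n) = 0) * (xl vc = 0) * (xl vl = 1))%type.
Proof. by case: (xlE m n). Qed.

Let coord := (linearD, linearN, scalarZ, linear0, xdP, xhP, xcP, xlP, mulr0, mulr1,
  addr0, add0r, oppr0).

Lemma dd_d_coefs m n k :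
  (m - n)%:~R * f (m + n) k = f n k * f m (n + k) - f m k * f n (m + k) /\
  (m - n)%:~R * w (m + n) k = f n k * w m (n + k) - f m k * w n (m + k).
Proof.
have := mul_rep (vd m) (vd n) (vd k).
rewrite brdd !(expand, table) !scaler0 !addr0 !addrA (addrC n m) => e.
split; [have := congr1 (xd (m + n + k)) e | have := congr1 xc e];
  by rewrite !coord.
Qed.

Lemma dh_d_coefs m n k :
  - half n * h (m + n) k = h n k * g m (n + k) - f m k * h n (m + k).
Proof.
have := mul_rep (vd m) (vh n) (vd k).
rewrite brdh !(expand, table) !scaler0 !addr0 !addrA (addrC n m) => e.
by have := congr1 (xh (m + n + k)) e; rewrite !coord.
Qed.

Lemma dh_h_coefs m n k :
  [/\ - half n * a (m + n) k = a n k * f m (n + k) - g m k * a n (m + k),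
      - half n * b (m + n) k = b n k * g m (n + k) - g m k * b n (m + k)
    & - half n * rho (m + n) k = - (g m k * rho n (m + k))].
Proof.
have := mul_rep (vd m) (vh n) (vh k).
rewrite brdh !(expand, table) !scaler0 !addr0 !addrA (addrC n m) => e.
split; [have := congr1 (xd (m + n + k)) e | have := congr1 (xh (m + n + k)) e
  | have := congr1 xl e]; rewrite !coord //.
Qed.

Theorem graded_product_form : exists eps : K,
  [/\ eps != 0, forall k : int, eps^-1 != k%:~R
    & [/\ forall m n : int, mul (vd m) (vd n) =
            - (n%:~R * (1 + eps * n%:~R) / (1 + eps * (m + n)%:~R)) *: vd (m + n)
            + (24^-1 * ((m ^+ 3 - m)%:~R + (eps - eps^-1) * (m ^+ 2)%:~R)
                * (m + n == 0)%:R) *: vc,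
          forall m n : int, mul (vd m) (vh n) = - half n *: vh (m + n),
          forall m n : int, mul (vh m) (vd n) = 0
        & forall m n : int, mul (vh m) (vh n) =
            (2^-1 * half m * (m + n + 1 == 0)%:R) *: vl]].
Proof.
have fC m n : f m n - f n m = (m - n)%:~R.
  have := congr1 (xd (m + n)) (brdd m n).
  by rewrite !mdd [n + m]addrC !coord.
have wC m n : w m n - w n m = (m ^+ 3 - m)%:~R / 12 * (m + n == 0)%:R.
  have := congr1 xc (brdd m n).
  by rewrite !mdd [n + m]addrC !coord.
have ghC m n : g m n - h n m = - half n.
  have := congr1 (xh (m + n)) (brdh m n).
  by rewrite mdh mhd [n + m]addrC !coord.
have rhoC m n : rho m n - rho n m = half m * (m + n + 1 == 0)%:R.
  have := congr1 xl (brhh m n).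
  by rewrite !mhh [n + m]addrC !coord.
have fL m n k := (dd_d_coefs m n k).1; have wL m n k := (dd_d_coefs m n k).2.
have f0 := left_weight fC (right_weight_eq0 fC fL wC wL).
have [eps [eps0 D0 fE wE]] := virasoro_form fC fL wC wL.
have f11 : f 1 1 + f (-1) (-1) != 0.
  have -> : f 1 1 + f (-1) (-1) =
      2 * eps / ((1 + eps * 2%:~R) * (1 + eps * (-2)%:~R)).
    rewrite !fE -[(1 + 1)%R]/(2 : int) -[(-1 + -1)%R]/(-2 : int).
    by field; have := D0 2; have := D0 (-2); rewrite rmorphN => -> ->.
  by rewrite mulf_neq0 ?invr_eq0 ?mulf_neq0 ?D0 ?pnatr_eq0.
have [gE hE aE bE rhoE] : _ := heisenberg_form f0 f11 ghC rhoC dh_d_coefs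
  (fun m n k => let: And3 p _ _ := dh_h_coefs m n k in p)
  (fun m n k => let: And3 _ p _ := dh_h_coefs m n k in p)
  (fun m n k => let: And3 _ _ p := dh_h_coefs m n k in p).
exists eps; split=> // [k|].
  (* an inverse [eps^-1 = k] would make [1 + eps * j] vanish at [j = - k] *)
  apply/eqP => ek; have := D0 (- k).
  by rewrite mulrNz -ek mulrN divff // subrr eqxx.
split=> m n.
- by rewrite mdd fE wE.
- by rewrite mdh gE.
- by rewrite mhd hE scale0r.
- by rewrite mhh aE bE rhoE !scale0r !add0r.
Qed.
End GradedProduct.

(** * The mirror Heisenberg-Virasoro algebra *)
Section Coordinates.
Variable R : realType.

Definition coord (x : mhv_basis) (u : mhv R) : R[i] := mcoeff x u.

Lemma coord_linear x : linear (coord x : mhv R -> R[i]^o).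
Proof. by move=> c u v; rewrite /coord mcoeffD mcoeffZ. Qed.

HB.instance Definition _ x :=
  GRing.isLinear.Build R[i] (mhv R) R[i] *%R (coord x) (coord_linear x).

Lemma coord_vect x y : coord x (vect R y) = (y == x)%:R.
Proof. by rewrite /coord /vect mcoeffU. Qed.

Lemma mhv_bracket_vect x y :
  mhv_bracket (vect R x) (vect R y) = mhv_bracket_basis R x y.
Proof.
rewrite /mhv_bracket /vect !msuppU oner_eq0 !big_seq_fset1 !mcoeffUU.
by rewrite mulr1 scale1r.
Qed.
End Coordinates.

Theorem theorem13 (R : realType) (mul : {bilinear mhv R -> mhv R -> mhv R}) :
  compatible_left_symmetric mul ->
  natural_grading mul ->
  exists eps : R[i],
    [/\ eps != 0,
        forall k : int, eps^-1 != k%:~R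
      & forall x y : mhv_basis, mul (vect R x) (vect R y) = mhv_table eps x y].
Proof.
move=> [LS MC] [f [g [h [a [b [w [rho [Mdd Mdh Mhd Mhh Mz]]]]]]]].
have com x y : mul (vect R x) (vect R y) - mul (vect R y) (vect R x) =
    mhv_bracket_basis R x y by rewrite MC mhv_bracket_vect.
have Mcx x : mul (vc R) (vect R x) = 0 by case: (Mz x).
have Mxc x : mul (vect R x) (vc R) = 0 by case: (Mz x).
have Mlx x : mul (vl R) (vect R x) = 0 by case: (Mz x).
have Mxl x : mul (vect R x) (vl R) = 0 by case: (Mz x).
have [||||eps [eps0 D0 [Tdd Tdh Thd Thh]]] := @graded_product_form R[i] (mhv R) mul
  (vd R) (vh R) (vc R) (vl R)
  (fun m => coord (Bd m)) (fun m => coord (Bh m)) (coord Bc) (coord Bl)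
  f g h a b w rho
  _ _ _ _
  LS (fun m n => com (Bd m) (Bd n)) (fun m n => com (Bd m) (Bh n))
  (fun m n => com (Bh m) (Bh n)) Mdd Mdh Mhd Mhh
  (fun m => Mxc (Bd m)) (fun m => Mcx (Bd m)) (fun m => Mxl (Bd m))
  (fun m => Mxc (Bh m));
  try by move=> m n; split; rewrite [LHS]coord_vect ?eqxx.
exists eps; split; [exact: eps0|exact: D0|move=> x y].
case: x => [m|m||]; [case: y => [n|n||]|case: y => [n|n||]| |].
- exact: Tdd.
- exact: Tdh.
- exact: Mxc.
- exact: Mxl.
- exact: Thd.
- exact: Thh.
- exact: Mxc.
- exact: Mxl.
- exact: Mcx.
- exact: Mlx.
Qed.
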